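(* There exists a compactly supported Borel probability measure $\mu$ on $\mathbb{R}$ that is absolutely continuous with respect to Lebesgue measure (i.e. $\mu\in L^1$), such that $\dim_{\mathrm A}\mu=1$ but $\mu\notin L^p$ for every $p>1$.
   Context: For a compactly supported Borel probability measure $\mu$ on $\mathbb{R}$, with support $\operatorname{supp}\mu$, the Assouad dimension of $\mu$ is $$\dim_{\mathrm A}\mu=\inf\Big\{\alpha:\ \exists C>0\ \forall\,0<r<R<1\ \forall x\in\operatorname{supp}\mu,\ \tfrac{\mu(B(x,R))}{\mu(B(x,r))}\leq C\left(\tfrac Rr\right)^{\alpha}\Big\},$$ where $B(x,r)$ is the ball (interval) of centre $x$ and radius $r$. For $p\geq1$, $\mu\in L^p$ means that $\mu$ is absolutely continuous with respect to Lebesgue measure with density $f$ satisfying $\int f^p\,dx<\infty$. *)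

(* Defs.v *)
From HB Require Import structures.
From mathcomp Require Import all_boot all_order all_algebra.
From mathcomp Require Import all_classical all_reals all_analysis.
Set Implicit Arguments.
Unset Strict Implicit.
Unset Printing Implicit Defensive.
Import Order.TTheory GRing.Theory Num.Theory.
Import numFieldNormedType.Exports.

Local Open Scope classical_set_scope.
Local Open Scope ring_scope.

(* Borel measures on the line are measures on [measurableTypeR R], i.e. [R]
   equipped with its Borel sigma-algebra. *)

Definition msupport (R : realType)
    (mu : {measure set (measurableTypeR R) -> \bar R}) : set R :=
  [set x | forall e : R, 0 < e -> (0 < mu (ball x e))%E].

(* [ball x r] is the open interval of centre [x] and radius [r].  Both measures
   in the quotient are finite, and the denominator is positive because [x] lies
   in the support, so [fine] and the division of [R] are harmless. *)
Definition assouad_dim (R : realType)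
    (mu : probability (measurableTypeR R) R) : \bar R :=
  ereal_inf [set alpha%:E | alpha in [set alpha : R |
    exists2 C : R, 0 < C &
      forall r s x : R, 0 < r -> r < s -> s < 1 -> msupport mu x ->
        fine (mu (ball x s)) / fine (mu (ball x r)) <= C * (s / r) `^ alpha]].

Definition is_density (R : realType)
    (mu : {measure set (measurableTypeR R) -> \bar R})
    (f : measurableTypeR R -> R) : Prop :=
  [/\ measurable_fun setT f,
      forall x, 0 <= f x
    & forall A : set (measurableTypeR R), measurable A ->
        mu A = (\int[lebesgue_measure]_(x in A) (f x)%:E)%E].

Definition in_Lp (R : realType)
    (mu : {measure set (measurableTypeR R) -> \bar R}) (p : R) : Prop :=
  mu `<< (@lebesgue_measure R) /\
  exists2 f : measurableTypeR R -> R, is_density mu f &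
    (\int[lebesgue_measure]_x (f x `^ p)%:E < +oo)%E.

(* Main.v *)
Require Import Defs.
From HB Require Import structures.
From mathcomp Require Import all_boot all_order all_algebra.
From mathcomp Require Import all_classical all_reals all_analysis.
From mathcomp Require Import measurable_realfun ring lra zify.
Import Order.TTheory GRing.Theory Num.Theory.
Import numFieldNormedType.Exports.
Local Open Scope classical_set_scope.
Local Open Scope ring_scope.

Set Implicit Arguments.
Unset Strict Implicit.
Unset Printing Implicit Defensive.

(** The measure is a convex combination of multiplicative cascades.

    A triadic cascade distributes the mass of each triadic interval among its
    three thirds in the proportions (1 - a, 1 + 2a, 1 - a), where 0 <= a <= 1/2
    may depend on the generation.  The two outer thirds receive equal shares,
    so that two adjacent triadic intervals of the same generation have masses
    within a factor 4 of each other ([cell_weight_neighbour]), even when their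
    common ancestor is remote.  Hence the mass of a ball is comparable with the
    mass of any triadic interval of the same size that meets its centre, and
    the ratio of the masses of two concentric balls is governed by the products
    of the factors 3 / (1 - a) over the intermediate generations
    ([cascade_dim_bound]).

    The [j]-th component uses a = 1/(j+2) during its first [n j] generations
    and a = 0 afterwards, so its density is bounded.  For alpha > 1 the factor
    3 / (1 - a) is at most 3 `^ alpha as soon as [j] is large, and the finitely
    many other components violate this bound in boundedly many generations
    only.  So one constant serves all components ([uniform_descent]), and
    because the inequality mu(B(x,s)) <= K mu(B(x,r)) is preserved by convex
    combinations, the mixture has Assouad dimension at most 1.  It is at least 1
    because [0, 3^-m) has mass at most 3^-m for every component, its thirds
    having always been chosen on the left.

    On the other hand a cascade with constant a > 0 tends to a singular measure
    as its number of generations grows: the mean of the square root of its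
    density is the [n]-th power of a number smaller than 1.  So [n j] can be
    chosen such that half of the mass of the [j]-th component sits on a set of
    Lebesgue measure at most 2^-(j^2+j+3) ([cascade_concentrates]).  With weight
    2^-(j+1) in the mixture this component rules out every p > 1
    ([concentrated_not_in_Lp]). *)

(** * Weights of triadic cells *)

Section Weights.
Variable R : realType.

Definition digit_weight (a : R) (d : nat) : R :=
  if d == 1%N then 1 + 2 * a else 1 - a.

(** The mean density of a cascade on the [i]-th triadic interval of generation
    [m]; the base 3 digits of [i] are the successive choices of a third.  Digits
    beyond the [m]-th are ignored, so the weight is periodic in [i]. *)
Fixpoint cell_weight (a : nat -> R) (m i : nat) : R :=
  if m is m'.+1
  then cell_weight a m' (i %/ 3) * digit_weight (a m') (i %% 3)
  else 1.

Definition admissible (a : nat -> R) := forall k, 0 <= a k <= 2^-1.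

Lemma digit_weight_ge (a : R) d : 0 <= a -> 1 - a <= digit_weight a d.
Proof. by rewrite /digit_weight; case: ifP => _; lra. Qed.

Lemma digit_weight_gt0 (a : R) d : 0 <= a <= 2^-1 -> 0 < digit_weight a d.
Proof. by move=> ha; have := @digit_weight_ge a d; lra. Qed.

Lemma cell_weight_gt0 a m i : admissible a -> 0 < cell_weight a m i.
Proof.
move=> ha; elim: m i => [|m IH] i //=.
by rewrite mulr_gt0 ?IH ?digit_weight_gt0.
Qed.

Lemma cell_weight_leftmost a m : admissible a -> cell_weight a m 0 <= 1.
Proof.
move=> ha; elim: m => [//|m IH] /=; rewrite div0n.
have := cell_weight_gt0 m 0 ha; have := ha m.
by rewrite /digit_weight /=; nra.
Qed.

Lemma divmod3 k d : (d < 3)%N -> ((3 * k + d) %/ 3 = k)%N * ((3 * k + d) %% 3 = d)%N.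
Proof. by move=> ?; split; lia. Qed.

Lemma cell_weight_child a m k d : (d < 3)%N ->
  cell_weight a m.+1 (3 * k + d) = cell_weight a m k * digit_weight (a m) d.
Proof. by move=> d3; rewrite /= !divmod3. Qed.

(** Only the lowest digit that is not carried distinguishes the weights of [k]
    and [k.+1]: the digits below it are 2 on one side and 0 on the other, and
    those have the same weight.  The remaining factor is at most
    (1 + 2a) / (1 - a) <= 4. *)
Lemma cell_weight_neighbour a m k : admissible a ->
  cell_weight a m k.+1 <= 4 * cell_weight a m k /\
  cell_weight a m k <= 4 * cell_weight a m k.+1.
Proof.
move=> ha; elim: m k => [|m IH] k; first by rewrite /=; split; lra.
have [q [d [d3 ->]]] : exists q d, (d < 3)%N /\ k = (3 * q + d)%N.
  by exists (k %/ 3)%N, (k %% 3)%N; split; lia.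
have w0 q' := cell_weight_gt0 m q' ha.
have [hm0 hm2] := andP (ha m).
move: d3; case: d => [|[|[|//]]] _.
- rewrite -addnS !cell_weight_child// /digit_weight /=.
  by have := w0 q; split; nra.
- rewrite -addnS !cell_weight_child// /digit_weight /=.
  by have := w0 q; split; nra.
- have -> : ((3 * q + 2).+1 = 3 * q.+1 + 0)%N by lia.
  rewrite !cell_weight_child// /digit_weight /=.
  by have := IH q; have := w0 q; have := w0 q.+1; case=> *; split; nra.
Qed.

Lemma cell_weight_descend a M l i : admissible a ->
  (\prod_(k < l) (1 - a (M + k)%N)) * cell_weight a M (i %/ 3 ^ l) <=
  cell_weight a (M + l) i.
Proof.
move=> ha; elim: l i => [|l IH] i.
  by rewrite big_ord0 mul1r addn0 expn0 divn1.
rewrite big_ord_recr addnS /= expnS divnMA mulrAC.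
apply: ler_pM; last by apply: digit_weight_ge; have /andP[] := ha (M + l)%N.
- rewrite mulr_ge0 ?prodr_ge0 ?(ltW (cell_weight_gt0 _ _ _))// => k _.
  by have := ha (M + k)%N; lra.
- by have := ha (M + l)%N; lra.
- exact: IH.
Qed.

Lemma cell_weight_frozen a n l i : (forall k, (n <= k)%N -> a k = 0) ->
  cell_weight a (n + l) i = cell_weight a n (i %/ 3 ^ l).
Proof.
move=> a0; elim: l i => [|l IH] i; first by rewrite addn0 expn0 divn1.
rewrite addnS /= IH expnS divnMA a0 ?leq_addr// /digit_weight.
by case: ifP => _; rewrite ?mulr0 ?addr0 ?subr0 mulr1.
Qed.

Lemma sum_base3 (H : nat -> R) N : \sum_(i < 3 * N) H i =
  \sum_(k < N) (H (3 * k + 0)%N + H (3 * k + 1)%N + H (3 * k + 2)%N).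
Proof.
elim: N => [|N IH]; first by rewrite muln0 !big_ord0.
have -> : (3 * N.+1 = (3 * N).+3)%N by lia.
by rewrite !big_ord_recr /= IH !addrA addn0 addn1 addn2.
Qed.

(** Independence of the digits.  It is used for the identity (total mass) and
    for the square root (concentration). *)
Lemma sum_multiplicative (f : R -> R) a m :
  f 1 = 1 -> {in Num.pos &, {morph f : x y / x * y}} -> admissible a ->
  \sum_(i < 3 ^ m) f (cell_weight a m i) =
  \prod_(k < m) (2 * f (1 - a k) + f (1 + 2 * a k)).
Proof.
move=> f1 fM ha; elim: m => [|m IH].
  by rewrite expn0 big_ord0 big_ord1 /= f1.
rewrite big_ord_recr /= -IH mulr_suml expnS.
rewrite (sum_base3 (fun i => f (cell_weight a m.+1 i))).
apply: eq_bigr => k _; rewrite !cell_weight_child//.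
have ? := cell_weight_gt0 m k ha.
by rewrite !fM ?posrE ?digit_weight_gt0// /digit_weight /=; ring.
Qed.

Lemma sum_cell_weight a m : admissible a ->
  \sum_(i < 3 ^ m) cell_weight a m i = 3 ^+ m.
Proof.
move=> ha; rewrite (sum_multiplicative (f := id))//.
rewrite -[in RHS](card_ord m) -prodr_const.
by apply: eq_bigr => k _; ring.
Qed.

(** Strict concavity of the square root: the three thirds have mean weight 1
    and are not all equal. *)
Lemma sqrt_mean_lt3 (a : R) : 0 < a <= 2^-1 ->
  2 * Num.sqrt (1 - a) + Num.sqrt (1 + 2 * a) < 3.
Proof.
move=> ha; have ha1 : 0 <= 1 - a by lra.
have ha2 : 0 <= 1 + 2 * a by lra.
have := sqr_sqrtr ha1; have := sqr_sqrtr ha2.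
have := sqrtr_ge0 (1 - a); have := sqrtr_ge0 (1 + 2 * a).
set u := Num.sqrt _; set v := Num.sqrt _ => u0 v0 hu hv.
rewrite ltNge; apply/negP => h.
(* 3 (2 u^2 + v^2) - (2 u + v)^2 = 2 (u - v)^2, and 2 u^2 + v^2 = 3. *)
have uv : (u - v) ^+ 2 = 0.
  by apply/eqP; rewrite eq_le sqr_ge0 andbT; nra.
move/eqP: uv; rewrite sqrf_eq0 subr_eq0 => /eqP uv; rewrite uv in hu.
nra.
Qed.
End Weights.

(** * Triadic cells and cascade measures *)

Section Cells.
Variable R : realType.
Notation lambda := (@lebesgue_measure R).

Definition cell (m i : nat) : set (measurableTypeR R) :=
  `[i%:R / 3 ^+ m, i.+1%:R / 3 ^+ m[%classic.

Lemma cellP m i (x : R) : cell m i x <-> i%:R <= x * 3 ^+ m < i.+1%:R.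
Proof.
have h : 0 < 3 ^+ m :> R by rewrite exprn_gt0.
by rewrite /cell /= in_itv /= ler_pdivrMr// ltr_pdivlMr.
Qed.

Lemma measurable_cell m i : measurable (cell m i).
Proof. exact: measurable_itv. Qed.

Lemma lebesgue_cell m i : lambda (cell m i) = (3 ^- m)%:E.
Proof.
rewrite /cell lebesgue_measure_itv /= lte_fin ltr_pM2r ?invr_gt0 ?exprn_gt0//.
rewrite ltr_nat leqnn -EFinD; congr EFin.
by rewrite -mulrBl -natrB// subSnn mul1r.
Qed.

Lemma cell_descend M l i : cell (M + l) i `<=` cell M (i %/ 3 ^ l).
Proof.
move=> x /cellP /andP[h1 h2]; apply/cellP.
have h : 0 < 3 ^+ l :> R by rewrite exprn_gt0.
rewrite exprD mulrA in h1 h2.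
have := divn_eq i (3 ^ l); have := ltn_pmod i (expn_gt0 3 l).
set q := (i %/ _)%N; set r := (i %% _)%N => hr hi.
have {}h1 : (q * 3 ^ l)%:R <= x * 3 ^+ M * 3 ^+ l :> R.
  by apply: le_trans h1; rewrite ler_nat hi leq_addr.
have {}h2 : x * 3 ^+ M * 3 ^+ l < (q.+1 * 3 ^ l)%:R :> R.
  by apply: lt_le_trans h2 _; rewrite ler_nat hi mulSn addnC; lia.
move: h1 h2; rewrite !natrM !natrX ler_pM2r// ltr_pM2r// => -> ->.
by [].
Qed.

Lemma cell_disjoint m i k : i <> k -> cell m i `&` cell m k = set0.
Proof.
move=> ik; rewrite -subset0 => x [/cellP/andP[h1 h2] /cellP/andP[h3 h4]].
apply: ik; have := le_lt_trans h1 h4; have := le_lt_trans h3 h2.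
by rewrite !ltr_nat; lia.
Qed.

Lemma cell_trisect m k :
  cell m k = cell m.+1 (3 * k + 0) `|` (cell m.+1 (3 * k + 1)
             `|` cell m.+1 (3 * k + 2)).
Proof.
have hn d : (3 * k + d).+1%:R = 3 * k%:R + d.+1%:R :> R.
  by rewrite -addnS natrD natrM.
have hd d : (3 * k + d)%:R = 3 * k%:R + d%:R :> R by rewrite natrD natrM.
have h3 (x : R) : x * 3 ^+ m.+1 = 3 * (x * 3 ^+ m) by rewrite exprS mulrCA.
apply/seteqP; split=> x.
- move=> /cellP; rewrite -(natr1 k) => xk.
  have [c1|c1] := ltP (x * 3 ^+ m : R) (k%:R + 3^-1).
    by left; apply/cellP; rewrite hn hd h3; move: xk c1; set y : R := x * _; lra.
  have [c2|c2] := ltP (x * 3 ^+ m : R) (k%:R + 2 / 3).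
    by right; left; apply/cellP; rewrite hn hd h3; move: xk c1 c2; set y : R := x * _; lra.
  by right; right; apply/cellP; rewrite hn hd h3; move: xk c2; set y : R := x * _; lra.
- by move=> [|[|]] /cellP; rewrite hn hd h3 => xk; apply/cellP; move: xk;
     rewrite -natr1; set y : R := x * _; lra.
Qed.

(** The absolute value only serves to have a manifestly nonnegative scalar; it
    disappears in [cascadeE]. *)
Definition cascade (a : nat -> R) (n : nat)
    : {measure set (measurableTypeR R) -> \bar R} :=
  msum (fun i => mscale `|cell_weight a n i|%:nng
                   (mrestr lambda (measurable_cell n i))) (3 ^ n).

Lemma cascadeE a n A : admissible a ->
  cascade a n A =
  (\sum_(i < 3 ^ n) (cell_weight a n i)%:E * lambda (A `&` cell n i))%E.
Proof.
move=> ha; rewrite /cascade /= /msum; apply: eq_bigr => i _.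
by rewrite /= /mscale /mrestr /= ger0_norm// ltW// cell_weight_gt0.
Qed.

Lemma cascade_sub_cell a n i A : admissible a -> (i < 3 ^ n)%N ->
  A `<=` cell n i -> cascade a n A = ((cell_weight a n i)%:E * lambda A)%E.
Proof.
move=> ha hi hA; rewrite cascadeE// (bigD1 (Ordinal hi))//= big1 ?adde0.
  by rewrite (setIidl hA).
move=> k hk; have -> : A `&` cell n k = set0.
  rewrite -subset0 -(@cell_disjoint n i k); first exact: setSI.
  by move=> ik; case/eqP: hk; apply/val_inj.
by rewrite measure0 mule0.
Qed.

(** Refining beyond generation [n] multiplies all weights by 1, which gives the
    fine cells; the coarse ones follow upwards, because the three weights of
    the thirds of a cell have mean 1. *)
Lemma cascade_cell a n m k : admissible a -> (forall k, (n <= k)%N -> a k = 0) ->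
  (k < 3 ^ m)%N -> cascade a n (cell m k) = (cell_weight a m k / 3 ^+ m)%:E.
Proof.
move=> ha a0.
have fine_case l i : (i < 3 ^ (n + l))%N ->
    cascade a n (cell (n + l) i) = (cell_weight a (n + l) i / 3 ^+ (n + l))%:E.
  move=> hi; rewrite (@cascade_sub_cell _ _ (i %/ 3 ^ l))//.
  - by rewrite lebesgue_cell -EFinM cell_weight_frozen.
  - by rewrite ltn_divLR ?expn_gt0// -expnD.
  - exact: cell_descend.
have [/subnKC <-|/ltnW/subKn <-] := leqP n m; first exact: fine_case.
elim: (n - m)%N k => {m} [|l IH] k.
  by rewrite subn0; have := fine_case 0%N k; rewrite addn0.
have [ln|nl] := ltnP l n; last by rewrite (_ : n - l.+1 = n - l)%N; [exact: IH|lia].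
move: IH; have -> : (n - l = (n - l.+1).+1)%N by lia.
set m := (n - l.+1)%N => IH hk.
have hd d : (d < 3)%N -> (3 * k + d < 3 ^ m.+1)%N by rewrite expnS; lia.
rewrite cell_trisect.
do 2 (rewrite measureU; [|exact: measurable_cell|
  by repeat apply: measurableU; exact: measurable_cell|
  by rewrite ?setIUr !cell_disjoint ?setU0//; lia]).
transitivity (\sum_(d < 3) cascade a n (cell m.+1 (3 * k + d)))%E.
  by rewrite !big_ord_recr big_ord0 /= add0e -addeA.
under eq_bigr do rewrite IH ?hd//.
rewrite !big_ord_recr big_ord0 /= add0e !divmod3// -!EFinD; congr EFin.
rewrite /digit_weight /= exprS.
by field; rewrite expf_neq0.
Qed.

Lemma cascade_inside a n A : admissible a ->
  cascade a n A = cascade a n (A `&` cell 0 0).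
Proof.
move=> ha; rewrite !cascadeE//; apply: eq_bigr => i _.
rewrite -setIA (@setIidr _ (cell 0 0))//.
by have := @cell_descend 0 n i; rewrite divn_small.
Qed.

Lemma cascade_outside a n A : admissible a ->
  A `&` cell 0 0 = set0 -> cascade a n A = 0%E.
Proof. by move=> ha hA; rewrite cascade_inside// hA measure0. Qed.

Lemma cascade_cell_le a n m k : admissible a ->
  (forall k, (n <= k)%N -> a k = 0) ->
  (cascade a n (cell m k) <= (cell_weight a m k / 3 ^+ m)%:E)%E.
Proof.
move=> ha a0; have [hk|hk] := ltnP k (3 ^ m); first by rewrite cascade_cell.
rewrite cascade_outside//.
  by rewrite lee_fin divr_ge0// ltW// cell_weight_gt0.
rewrite -subset0 setIC.
apply: (@subset_trans _ (cell 0 0 `&` cell 0 (k %/ 3 ^ m))).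
  by apply: setIS; exact: (@cell_descend 0 m k).
rewrite cell_disjoint// => /esym/eqP.
by rewrite -leqn0 leqNgt divn_gt0 ?expn_gt0// hk.
Qed.

End Cells.

(** * Masses of balls under a cascade *)

Section Balls.
Variable R : realType.

Lemma triadic_scale (r : R) : 0 < r <= 1 ->
  exists m : nat, 3 ^- m.+1 < r <= 3 ^- m.
Proof.
move=> /andP[r0 r1].
have ex : exists m : nat, 3 ^- m < r.
  exists (Num.bound r^-1); rewrite invf_plt ?posrE ?exprn_gt0//.
  apply: lt_le_trans (archi_boundP _) _; first by rewrite invr_ge0 ltW.
  by rewrite -natrX ler_nat ltnW// ltn_expl.
case: (ex_minnP ex) => -[|m] hm hmin.
  by move: hm; rewrite expr0 invr1 ltNge r1.
exists m; rewrite hm/= leNgt; apply/negP => /hmin.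
by rewrite ltnn.
Qed.

(** The right end point [x = 1] lies in none of the half-open cells that make up
    the unit interval, so closed cells are used. *)
Lemma cell_near (x : R) m : 0 <= x <= 1 ->
  exists2 i, (i < 3 ^ m)%N & i%:R <= x * 3 ^+ m <= i.+1%:R.
Proof.
move=> /andP[x0 x1].
have p : 0 < 3 ^+ m :> R by rewrite exprn_gt0.
have : x < 1 \/ x = 1 by move: x1; rewrite le_eqVlt => /predU1P[]; [right|left].
case=> [x1'|->].
  have y0 : 0 <= x * 3 ^+ m by rewrite mulr_ge0// ltW.
  have /andP[h1 h2] := truncn_itv y0.
  exists (Num.truncn (x * 3 ^+ m)); last by rewrite h1 ltW.
  rewrite -(ltr_nat R) natrX; apply: le_lt_trans h1 _.
  by rewrite gtr_pMl.
exists (3 ^ m).-1; first by rewrite ltn_predL expn_gt0.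
rewrite prednK ?expn_gt0// mul1r natrX lexx andbT -natrX ler_nat.
exact: leq_pred.
Qed.

Lemma near_ancestor (x : R) M l i : i%:R <= x * 3 ^+ (M + l) <= i.+1%:R ->
  (i %/ 3 ^ l)%:R <= x * 3 ^+ M <= (i %/ 3 ^ l).+1%:R.
Proof.
move=> /andP[h1 h2].
have h : 0 < 3 ^+ l :> R by rewrite exprn_gt0.
rewrite exprD mulrA in h1 h2.
have := divn_eq i (3 ^ l); have := ltn_pmod i (expn_gt0 3 l).
set k := (i %/ _)%N; set r := (i %% _)%N => hr hi.
have {}h1 : (k * 3 ^ l)%:R <= x * 3 ^+ M * 3 ^+ l :> R.
  by apply: le_trans h1; rewrite ler_nat hi leq_addr.
have {}h2 : x * 3 ^+ M * 3 ^+ l <= (k.+1 * 3 ^ l)%:R :> R.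
  by apply: le_trans h2 _; rewrite ler_nat hi mulSn addnC; lia.
by move: h1 h2; rewrite !natrM !natrX !ler_pM2r// => -> ->.
Qed.

Lemma cell_sub_ball (x r : R) m i : i%:R <= x * 3 ^+ m <= i.+1%:R ->
  3 ^- m < r -> cell m i `<=` ball x r.
Proof.
move=> hx hr y /cellP hy.
have p : 0 < 3 ^+ m :> R by rewrite exprn_gt0.
rewrite /ball /=; apply: le_lt_trans hr.
rewrite -(ler_pM2r p) mulVf ?gt_eqF// -[X in _ * X](gtr0_norm p) -normrM mulrBl.
move: hx hy; set u : R := x * _; set v : R := y * _.
by rewrite ler_norml -natr1; lra.
Qed.

(** A ball of radius at most one cell width reaches no further than the two
    cells adjacent to a cell that contains its centre.  For [k = 0] the left
    neighbour is missing, and the truncated predecessor harmlessly repeats [k]. *)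
Lemma ball_sub_cells (x r : R) M k : k%:R <= x * 3 ^+ M <= k.+1%:R ->
  r <= 3 ^- M ->
  ball x r `&` cell 0 0 `<=`
  cell M k.-1 `|` (cell M k `|` cell M k.+1).
Proof.
move=> hx hr y [hy /cellP /andP[y0 _]].
have p : 0 < 3 ^+ M :> R by rewrite exprn_gt0.
have {hy hr} hy : `|x - y| < 3 ^- M := lt_le_trans hy hr.
rewrite -(ltr_pM2r p) mulVf ?gt_eqF// in hy.
rewrite -[X in _ * X](gtr0_norm p) -normrM mulrBl in hy.
have {y0} : 0 <= y * 3 ^+ M :> R.
  by rewrite expr0 mulr1 in y0; rewrite mulr_ge0// ltW.
move: hx hy; set u : R := x * _; set v : R := y * _ => hx.
rewrite ltr_norml => hy v0.
have [c1|c1] := ltP v k%:R.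
  left; apply/cellP; rewrite -/v; case: k hx c1 => [|k] /=; first lra.
  by rewrite -!natr1; lra.
have [c2|c2] := ltP v k.+1%:R; first by right; left; apply/cellP; rewrite -/v c1.
by right; right; apply/cellP; rewrite -/v c2/=; move: hx hy; rewrite -!natr1; lra.
Qed.

Lemma cascade_ball_ge a n (x r : R) m i : admissible a ->
  (forall k, (n <= k)%N -> a k = 0) -> (i < 3 ^ m)%N ->
  i%:R <= x * 3 ^+ m <= i.+1%:R -> 3 ^- m < r ->
  ((cell_weight a m i / 3 ^+ m)%:E <= cascade a n (ball x r))%E.
Proof.
move=> ha a0 hi hx hr; rewrite -(@cascade_cell _ _ n)//.
by apply: le_measure; rewrite ?inE; [exact: measurable_cell|exact: measurable_ball|
  exact: cell_sub_ball].
Qed.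

(** The constant is 9 = 4 + 1 + 4: the cell near the centre and two neighbours of
    comparable weight. *)
Lemma cascade_ball_le a n (x r : R) M k : admissible a ->
  (forall k, (n <= k)%N -> a k = 0) ->
  k%:R <= x * 3 ^+ M <= k.+1%:R -> r <= 3 ^- M ->
  (cascade a n (ball x r) <= (9 * cell_weight a M k / 3 ^+ M)%:E)%E.
Proof.
move=> ha a0 hx hr; rewrite cascade_inside//.
have mc i : measurable (@cell R M i) by exact: measurable_cell.
apply: (@le_trans _ _ (cascade a n (cell M k.-1 `|` (cell M k `|` cell M k.+1)))).
  apply: le_measure; rewrite ?inE.
  - by apply: measurableI; [exact: measurable_ball|exact: measurable_cell].
  - by apply: measurableU => //; apply: measurableU.
  - exact: ball_sub_cells.
apply: le_trans (measureU2 _ (mc _) (measurableU _ _ (mc _) (mc _))) _.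
apply: le_trans (leeD (cascade_cell_le _ _ ha a0)
  (le_trans (measureU2 _ (mc _) (mc _))
    (leeD (cascade_cell_le _ _ ha a0) (cascade_cell_le _ _ ha a0)))) _.
rewrite -!EFinD lee_fin -!mulrDl ler_pM2r ?invr_gt0 ?exprn_gt0//.
have : cell_weight a M k.-1 <= 4 * cell_weight a M k.
  case: k {hx} => [|k] /=; first by have := cell_weight_gt0 M 0 ha; lra.
  by have [] := cell_weight_neighbour M k ha.
by have [? _] := cell_weight_neighbour M k ha; lra.
Qed.

(** The ball of radius [s] is compared with a cell of generation [M], the ball of
    radius [r] with a descendant of that cell [l] generations below, where
    3 ^+ l is s / r up to the factor 9; the hypothesis bounds the loss of mass
    during the descent. *)
Lemma cascade_dim_bound a n (alpha C : R) : admissible a ->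
  (forall k, (n <= k)%N -> a k = 0) -> 0 <= alpha ->
  (forall M l : nat,
     3 ^+ l <= C * (3 ^+ l) `^ alpha * \prod_(k < l) (1 - a (M + k)%N)) ->
  forall r s x : R, 0 < r -> r < s -> s < 1 -> 0 <= x <= 1 ->
  (cascade a n (ball x s) <=
   (9 * C * 9 `^ alpha * (s / r) `^ alpha)%:E * cascade a n (ball x r))%E.
Proof.
move=> ha a0 al0 hC r s x r0 rs s1 hx.
have s0 := lt_trans r0 rs.
have [M /andP[hM1 hM2]] := @triadic_scale s (ltac:(by rewrite s0 ltW)).
have [m /andP[hm1 hm2]] := @triadic_scale r (ltac:(by rewrite r0 ltW// (lt_trans rs))).
have Mm : (M < m.+1)%N.
  have := lt_le_trans (lt_trans hm1 rs) hM2.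
  by rewrite ltf_pV2 ?posrE ?exprn_gt0// ltr_eXn2l ?ltr1n.
have C0 : 0 <= C.
  by have := hC 0%N 0%N; rewrite big_ord0 expr0 powR1; lra.
have [l ml] : exists l, m.+1 = (M + l)%N.
  by exists (m.+1 - M)%N; rewrite subnKC// ltnW.
rewrite ml in hm1.
have sr : 3 ^+ l <= 9 * (s / r).
  rewrite mulrA ler_pdivlMr//.
  have e : 3 ^+ l * 3 ^- m = 3 * 3 ^- M :> R.
    by apply/eqP; rewrite eqr_div ?expf_neq0// -exprS ml exprD mulrC.
  apply: le_trans (ler_wpM2l (exprn_ge0 l (ler0n R 3)) hm2) _; rewrite e.
  by move: hM1; rewrite exprS invfM; lra.
have [i hi ix] := cell_near (M + l) hx.
apply: le_trans (cascade_ball_le ha a0 (near_ancestor ix) hM2) _.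
have K0 : 0 <= 9 * C * 9 `^ alpha * (s / r) `^ alpha.
  by rewrite !mulr_ge0// powR_ge0.
apply: le_trans (lee_wpmul2l _ (cascade_ball_ge ha a0 hi ix hm1)); last first.
  by rewrite lee_fin.
rewrite -EFinM lee_fin.
have /= := cell_weight_descend M l i ha.
set w := cell_weight a M _; set w' := cell_weight _ _ _; set P := \prod_(_ < _) _.
move=> hw.
have w0 : 0 < w by exact: cell_weight_gt0.
have w'0 : 0 < w' by exact: cell_weight_gt0.
have hM3 : 3 ^- M = 3 ^+ l * 3 ^- (M + l) :> R.
  by rewrite exprD invfM mulrCA divff ?mulr1// expf_neq0.
rewrite hM3 !mulrA ler_pM2r ?invr_gt0 ?exprn_gt0//.
have hpow : (3 ^+ l) `^ alpha <= 9 `^ alpha * (s / r) `^ alpha.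
  rewrite -powRM//; last by rewrite divr_ge0// ltW.
  apply: ge0_ler_powR => //; rewrite nnegrE ?exprn_ge0//.
  by rewrite mulr_ge0// divr_ge0// ltW.
have hCl := hC M l; rewrite -/P in hCl.
have h1 : w * 3 ^+ l <= w * (C * (3 ^+ l) `^ alpha * P) by rewrite ler_pM2l.
have h2 : C * (3 ^+ l) `^ alpha * (P * w) <= C * (3 ^+ l) `^ alpha * w'.
  by apply: ler_wpM2l => //; rewrite mulr_ge0// powR_ge0.
have h3 : C * w' * (3 ^+ l) `^ alpha <= C * w' * (9 `^ alpha * (s / r) `^ alpha).
  by apply: ler_wpM2l => //; rewrite mulr_ge0// ltW.
lra.
Qed.
End Balls.

(** * Concentration of a cascade with constant parameter *)

Section Concentration.
Variable R : realType.
Notation lambda := (@lebesgue_measure R).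

Definition heavy_cells (a : nat -> R) n (T : R) : set (measurableTypeR R) :=
  \big[setU/set0]_(i < 3 ^ n | T <= cell_weight a n i) cell n i.

Lemma measurable_heavy_cells a n T : measurable (heavy_cells a n T).
Proof. by apply: bigsetU_measurable => i _; exact: measurable_cell. Qed.

(** Markov's inequality for the density. *)
Lemma lebesgue_heavy_cells a n T : admissible a -> 0 < T ->
  (lambda (heavy_cells a n T) <= T^-1%:E)%E.
Proof.
move=> ha T0.
apply: (@le_trans _ _ (\sum_(i < 3 ^ n | (T <= cell_weight a n i)%R) (3 ^- n)%:E)%E).
  pose bounded (A : set (measurableTypeR R)) c := measurable A /\ (lambda A <= c)%E.
  suff [] : bounded (heavy_cells a n T)
      (\sum_(i < 3 ^ n | (T <= cell_weight a n i)%R) (3 ^- n)%:E)%E by [].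
  apply: big_ind2.
  - by split; [exact: measurable0|rewrite measure0].
  - move=> A x B y [mA Ax] [mB By]; split; first exact: measurableU.
    by apply: le_trans (measureU2 _ mA mB) _; exact: leeD.
  - by move=> i _; split; [exact: measurable_cell|rewrite lebesgue_cell].
rewrite sumEFin lee_fin.
apply: (@le_trans _ _ (\sum_(i < 3 ^ n) (T^-1 * (cell_weight a n i * 3 ^- n)))).
  rewrite big_mkcond/=; apply: ler_sum => i _.
  have w0 := cell_weight_gt0 n i ha.
  have p : 0 < 3 ^- n :> R by rewrite invr_gt0 exprn_gt0.
  case: ifPn => [Tw|_]; last by rewrite !mulr_ge0// ltW// invr_gt0.
  by rewrite mulrA ler_peMl ?(ltW p)// mulrC ler_pdivlMr// mul1r.
rewrite -mulr_sumr -mulr_suml sum_cell_weight// divff ?mulr1// expf_neq0.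
Qed.

(** Where the density w is below T one has w <= sqrt T * sqrt w, so the mass of
    the light cells is at most sqrt T times the mean of sqrt w, which
    factorizes over the generations. *)
Lemma cascade_heavy_cells a n T : admissible a -> 0 < T ->
  ((1 - Num.sqrt T * \prod_(k < n)
      ((2 * Num.sqrt (1 - a k) + Num.sqrt (1 + 2 * a k)) / 3))%:E <=
    cascade a n (heavy_cells a n T))%E.
Proof.
move=> ha T0.
have w0 i := cell_weight_gt0 n i ha.
have p : 0 < 3 ^- n :> R by rewrite invr_gt0 exprn_gt0.
rewrite cascadeE//.
apply: (@le_trans _ _ (\sum_(i < 3 ^ n)
  (if T <= cell_weight a n i then cell_weight a n i * 3 ^- n else 0)%:E)%E);
  last first.
  apply: lee_sum => i _; case: ifPn => [Tw|_]; last first.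
    by rewrite mule_ge0// lee_fin ltW.
  rewrite (@setIidr _ (heavy_cells _ _ _)).
    by rewrite lebesgue_cell -EFinM.
  by rewrite /heavy_cells (bigD1 i)//=; exact: subsetUl.
rewrite sumEFin lee_fin prodf_div prodr_const card_ord.
rewrite -(sum_multiplicative (f := @Num.sqrt R)) ?sqrtr1//; last first.
  by move=> x y; rewrite !posrE => x0 _; rewrite sqrtrM// ltW.
rewrite lerBlDr -lerBlDl.
rewrite mulrA mulr_sumr mulr_suml.
have e1 : \sum_(i < 3 ^ n) cell_weight a n i * 3 ^- n = 1.
  by rewrite -mulr_suml sum_cell_weight// divff// expf_neq0.
rewrite -[X in X - _ <= _]e1 -sumrB; apply: ler_sum => i _.
case: ifPn => [Tw|].
  by rewrite subrr mulr_ge0 ?(ltW p)// mulr_ge0// sqrtr_ge0.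
rewrite -ltNge subr0 => wT; rewrite ler_pM2r//.
rewrite -{1}(sqr_sqrtr (ltW (w0 i))) expr2.
by rewrite ler_wpM2r ?sqrtr_ge0// ler_wsqrtr// ltW.
Qed.

Definition truncated (b : R) (n k : nat) : R := if (k < n)%N then b else 0.

Lemma admissible_truncated b n : 0 <= b <= 2^-1 -> admissible (truncated b n).
Proof. by move=> hb k; rewrite /truncated; case: ifP => // _; lra. Qed.

Lemma cascade_concentrates (b T : R) : 0 < b <= 2^-1 -> 0 < T ->
  exists n, (2^-1%:E <=
    cascade (truncated b n) n (heavy_cells (truncated b n) n T))%E.
Proof.
move=> hb T0.
pose s := (2 * Num.sqrt (1 - b) + Num.sqrt (1 + 2 * b)) / 3.
have s1 : s < 1 by rewrite ltr_pdivrMr// mul1r sqrt_mean_lt3.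
have s0 : 0 <= s.
  by rewrite divr_ge0// addr_ge0 ?sqrtr_ge0// mulr_ge0// sqrtr_ge0.
have sT : 0 < Num.sqrt T by rewrite sqrtr_gt0.
have [n hn] : exists n, s ^+ n <= (2 * Num.sqrt T)^-1.
  have e0 : 0 < (2 * Num.sqrt T)^-1 by rewrite invr_gt0 mulr_gt0.
  have /cvgr0Pnorm_le/(_ _ e0) [n _ hn] := @cvg_expr R s (ltac:(by rewrite ger0_norm)).
  by exists n; have := hn n (leqnn n); apply: le_trans; exact: ler_norm.
exists n; apply: le_trans (cascade_heavy_cells _ _ T0); last first.
  by apply: admissible_truncated; lra.
rewrite lee_fin.
under eq_bigr => k _ do rewrite /truncated ltn_ord.
rewrite prodr_const card_ord -/s.
have : Num.sqrt T * s ^+ n <= Num.sqrt T * (2 * Num.sqrt T)^-1 by rewrite ler_pM2l.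
by rewrite invfM mulrCA divff ?gt_eqF// mulr1; lra.
Qed.
End Concentration.

(** * Exclusion of a density in Lp *)

Section Exclusion.
Variable R : realType.
Notation lambda := (@lebesgue_measure R).

Lemma le_split_powR (t p y : R) : 0 < t -> 1 < p -> 0 <= y ->
  y <= t + t `^ (1 - p) * y `^ p.
Proof.
move=> t0 p1 y0; have [yt|ty] := leP y t.
  by apply: le_trans yt _; rewrite lerDl mulr_ge0// powR_ge0.
have yp : 0 < y by exact: lt_trans ty.
have tp : t `^ (p - 1) <= y `^ (p - 1).
  by apply: ge0_ler_powR; rewrite ?nnegrE ?subr_ge0 ltW.
have -> : t `^ (1 - p) = (t `^ (p - 1))^-1 by rewrite -powRN opprB.
have e : y `^ p = y * y `^ (p - 1).
  rewrite -{2}(powRr1 y0) -powRD ?(gt_eqF yp) ?implybT//.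
  by rewrite addrC subrK.
have tp0 : 0 < t `^ (p - 1) by exact: powR_gt0.
apply: (@le_trans _ _ (y * y `^ (p - 1) / t `^ (p - 1))); last first.
  by rewrite e mulrC lerDr ltW.
by rewrite ler_pdivlMr// ler_pM2l.
Qed.

(** The pointwise bound y <= t + t^(1-p) y^p replaces Hoelder's inequality. *)
Lemma density_mass_le (mu : {measure set (measurableTypeR R) -> \bar R}) f (p t : R) A :
  is_density mu f -> 1 < p -> 0 < t -> measurable A ->
  (mu A <= t%:E * lambda A +
     (t `^ (1 - p))%:E * \int[lambda]_x (f x `^ p)%:E)%E.
Proof.
move=> [mf f0 df] p1 t0 mA; rewrite df//.
have mfp (D : set (measurableTypeR R)) :
    measurable_fun D (EFin \o (fun x => f x `^ p)).
  apply/measurable_EFinP; apply: measurable_funTS.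
  by apply: (measurableT_comp (measurable_powR p)).
have tp0 : 0 <= t `^ (1 - p) by exact: powR_ge0.
apply: (@le_trans _ _ (\int[lambda]_(x in A)
    (t%:E + (t `^ (1 - p))%:E * (f x `^ p)%:E))%E).
  apply: ge0_le_integral => //.
  - by move=> x _; rewrite lee_fin.
  - by apply/measurable_EFinP; exact: measurable_funTS.
  - apply: emeasurable_funD; first exact: measurable_cst.
    by apply: measurable_funeM.
  - by move=> x _; rewrite -EFinM -EFinD lee_fin le_split_powR.
rewrite ge0_integralD//=.
- rewrite integral_cst//; apply: leeD => //.
  rewrite ge0_integralZl_EFin//; last by move=> x _; rewrite lee_fin powR_ge0.
  apply: lee_wpmul2l; first by rewrite lee_fin.
  apply: ge0_subset_integral => //.
  by move=> x _; rewrite lee_fin powR_ge0.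
- by move=> x _; rewrite lee_fin ltW.
- by move=> x _; rewrite mule_ge0// lee_fin powR_ge0.
- by apply: measurable_funeM.
Qed.

(** With t = 2^(j^2) the bound of [density_mass_le] reads
    2^-(j+2) <= 2^-(j+3) + 2^(-j^2 (p-1)) K, where K is the integral of f^p; this
    fails once j (p - 1) >= 2 and 2^j > 8 K. *)
Lemma concentrated_not_in_Lp (mu : {measure set (measurableTypeR R) -> \bar R}) :
  (forall j : nat, exists A, [/\ measurable A,
     (lambda A <= (2 ^- (j * j + j + 3))%:E)%E &
     ((2 ^- (j + 2))%:E <= mu A)%E]) ->
  forall p : R, 1 < p -> ~ in_Lp mu p.
Proof.
move=> hA p p1 [_ [f fd]].
set I := (\int[_]_x _)%E => Ifin.
have I0 : (0 <= I)%E by apply: integral_ge0 => x _; rewrite lee_fin powR_ge0.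
have {Ifin I0} [K K0 IK] : exists2 K : R, 0 <= K & I = K%:E.
  by case: I Ifin I0 => // r _ r0; exists r.
have p10 : 0 < p - 1 by rewrite subr_gt0.
have [j [j1 j2]] : exists j : nat, 2 <= j%:R * (p - 1) /\ 8 * K < 2 ^+ j.
  exists (maxn (Num.bound (2 / (p - 1))) (Num.bound (8 * K))); split.
    rewrite -ler_pdivrMr//.
    apply: le_trans (ltW (archi_boundP _)) _; first by rewrite divr_ge0// ltW.
    by rewrite ler_nat leq_maxl.
  by apply: upper_nthrootP; rewrite leq_maxr.
have [A [mA hlam hmu]] := hA j.
pose t : R := 2 ^+ (j * j).
have t0 : 0 < t by rewrite exprn_gt0.
have := le_trans hmu (density_mass_le fd p1 t0 mA).
rewrite -/I IK.
have h1 : (t%:E * lambda A <= (2 ^- (j + 3))%:E)%E.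
  apply: (le_trans (lee_wpmul2l _ hlam)); first by rewrite lee_fin ltW.
  rewrite -EFinM lee_fin -addnA exprD invfM mulrA divff ?mul1r//.
  by rewrite gt_eqF.
move=> /le_trans/(_ (leeD h1 (le_refl _))).
rewrite -EFinM -EFinD lee_fin => hK.
have q0 : 0 < 2 ^+ j :> R by rewrite exprn_gt0.
have hj : 2 ^- (j + 3) <= t `^ (1 - p) * K.
  move: hK; rewrite !exprD !invfM.
  by have : 0 < 2 ^- j :> R by [rewrite invr_gt0]; lra.
have ht : t `^ (1 - p) <= 2 ^- j * 2 ^- j.
  have -> : t `^ (1 - p) = (t `^ (p - 1))^-1 by rewrite -powRN opprB.
  rewrite -invfM lef_pV2 ?posrE ?mulr_gt0 ?powR_gt0//.
  rewrite /t exprM -[X in X `^ _]powR_mulrn ?(ltW q0)// -powRrM -expr2.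
  rewrite -[leLHS]powR_mulrn ?(ltW q0)//; apply: ler_powR => //.
  by rewrite exprn_ege1// ler1n.
have := le_trans hj (ler_wpM2r K0 ht).
rewrite exprD invfM -mulrA ler_pM2l ?invr_gt0// mulrC ler_pdivlMr//.
by lra.
Qed.

End Exclusion.

(** * A growth bound shared by all components *)

Section UniformDescent.
Variable R : realType.

(** At most [N] of the factors lie below 1. *)
Lemma prod_ge_halves (u : nat -> R) N M l :
  (forall k, 2^-1 <= u k) -> (forall k, (N <= k)%N -> 1 <= u k) ->
  2 ^- N <= \prod_(k < l) u (M + k)%N.
Proof.
move=> u2 u1.
suff h : 2 ^- (minn (M + l) N - M) <= \prod_(k < l) u (M + k)%N.
  apply: le_trans h; rewrite lef_pV2 ?posrE ?exprn_gt0// ler_eXn2l ?ltr1n//.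
  lia.
elim: l => [|l IH].
  by rewrite big_ord0 (_ : _ - _ = 0)%N ?expr0 ?invr1//; lia.
rewrite big_ord_recr /=.
have [h|h] := leqP N (M + l).
  rewrite (_ : minn (M + l.+1) N - M = minn (M + l) N - M)%N; last lia.
  apply: le_trans IH _; rewrite ler_peMr ?u1//.
  by apply: prodr_ge0 => k _; apply: le_trans (u2 _); rewrite invr_ge0.
rewrite (_ : minn (M + l.+1) N - M = (minn (M + l) N - M).+1)%N; last lia.
by rewrite exprSr invfM; apply: ler_pM => //; rewrite ?invr_ge0 ?exprn_ge0.
Qed.

Definition step_size (j : nat) : R := j.+2%:R^-1.

Lemma step_size_bounds j : 0 < step_size j <= 2^-1.
Proof.
rewrite /step_size invr_gt0 ltr0n/= lef_pV2 ?posrE ?ltr0n//.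
by rewrite ler_nat.
Qed.

(** Writing theta = 3 `^ (alpha - 1) > 1, the factor theta * (1 - a) of one
    generation is at least 1 unless [j] is small and the generation is one of
    the first [n j]; in that case it is still at least 1/2.  So the constant is
    2^N with N the largest of finitely many [n j]. *)
Lemma uniform_descent (n : nat -> nat) (alpha : R) : 1 < alpha ->
  exists C, forall j M l : nat,
    3 ^+ l <= C * (3 ^+ l) `^ alpha *
      \prod_(k < l) (1 - truncated (step_size j) (n j) (M + k)%N).
Proof.
move=> a1; pose theta : R := 3 `^ (alpha - 1).
have th1 : 1 < theta.
  have one : 1 `^ (alpha - 1) = 1 :> R by rewrite powR1.
  rewrite /theta -[ltLHS]one.
  by apply: gt0_ltr_powR; rewrite ?nnegrE ?subr_gt0// ltr1n.
have th0 : 0 < theta by apply: lt_trans th1.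
pose j0 := Num.bound (theta / (theta - 1)).
have hj0 j : (j0 <= j)%N -> 1 <= theta * (1 - step_size j).
  move=> jj.
  have : theta / (theta - 1) <= j.+2%:R.
    apply: le_trans (ltW (archi_boundP _)) _.
      by rewrite divr_ge0 ?subr_ge0// ltW.
    by rewrite ler_nat; rewrite -/j0; lia.
  rewrite ler_pdivrMr ?subr_gt0// => h.
  have : theta / j.+2%:R <= theta - 1 by rewrite ler_pdivrMr ?ltr0n// mulrC.
  rewrite /step_size; set z := _^-1; lra.
pose N := (\max_(j < j0) n j)%N.
exists (2 ^+ N) => j M l.
have hb := step_size_bounds j.
pose u k := theta * (1 - truncated (step_size j) (n j) k).
have u2 k : 2^-1 <= u k.
  by rewrite /u /truncated; case: ifP => _; nra.
have u1 k : (N <= k)%N -> 1 <= u k.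
  move=> Nk; rewrite /u /truncated; case: ifPn => [knj|_]; last by rewrite subr0 mulr1 ltW.
  apply: hj0; rewrite leqNgt; apply/negP => jlt.
  have := leq_bigmax (F := fun j : 'I_j0 => n j) (Ordinal jlt).
  by rewrite /= -/N; lia.
have := @prod_ge_halves u N M l u2 u1.
rewrite /u big_split /= prodr_const card_ord => h.
have -> : (3 ^+ l) `^ alpha = 3 ^+ l * theta ^+ l :> R.
  rewrite -!powR_mulrn ?(ltW th0)// /theta -!powRrM -powRD; last by rewrite pnatr_eq0 implybT.
  by congr (_ `^ _); ring.
set P := \prod_(_ < _) _ in h *.
have {}h : 1 <= 2 ^+ N * (theta ^+ l * P).
  by rewrite -ler_pdivrMl ?exprn_gt0// mulr1.
have p3 : 0 < 3 ^+ l :> R by rewrite exprn_gt0.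
have -> : 2 ^+ N * (3 ^+ l * theta ^+ l) * P =
    3 ^+ l * (2 ^+ N * (theta ^+ l * P)) by rewrite [RHS]mulrCA !mulrA.
by rewrite ler_peMr// ltW.
Qed.
End UniformDescent.

(** * The mixture of cascades *)

Section Mixture.
Variable R : realType.
Notation lambda := (@lebesgue_measure R).
Variable n : nat -> nat.

Let ha j : admissible (truncated (@step_size R j) (n j)).
Proof. by apply: admissible_truncated; have := step_size_bounds R j; lra. Qed.

Let a0 j k : (n j <= k)%N -> truncated (@step_size R j) (n j) k = 0.
Proof. by rewrite /truncated leqNgt => /negbTE ->. Qed.

Definition component (j : nat) := cascade (truncated (@step_size R j) (n j)) (n j).

Definition mixture : {measure set (measurableTypeR R) -> \bar R} :=
  mseries (fun j => mscale (2 ^- j.+1)%:nng (component j)) 0.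

Lemma mixtureE A :
  mixture A = (\sum_(0 <= j <oo) (2 ^- j.+1)%:E * component j A)%E.
Proof. by []. Qed.

Lemma series_halves : (\sum_(0 <= j <oo) (2 ^- j.+1)%:E = 1 :> \bar R)%E.
Proof.
have := @cvg_geometric_eseries_half R 1 0; rewrite expr0 divr1 => h.
apply/cvg_lim => //; move: h; rewrite /eseries/=.
by under eq_fun do under eq_bigr do rewrite natrX div1r addn1.
Qed.

Let half_ge0 j : (0 <= (2 ^- j.+1 : R)%:E)%E.
Proof. by rewrite lee_fin invr_ge0 exprn_ge0. Qed.

(** This is where convexity enters: a constant that serves every component
    serves the mixture. *)
Lemma mixture_le_scale (K : R) A B : 0 <= K ->
  (forall j, (component j A <= K%:E * component j B)%E) ->
  (mixture A <= K%:E * mixture B)%E.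
Proof.
move=> K0 h; rewrite !mixtureE -nneseriesZl; last by move=> j _; rewrite mule_ge0.
apply: lee_nneseries => [j _ _|j _]; first by rewrite mule_ge0.
by rewrite muleCA lee_wpmul2l.
Qed.

Lemma mixture_le (K : R) A : 0 <= K -> (forall j, (component j A <= K%:E)%E) ->
  (mixture A <= K%:E)%E.
Proof.
move=> K0 h; rewrite mixtureE -[leRHS]mule1 -series_halves -nneseriesZl//.
apply: lee_nneseries => [j _ _|j _]; first by rewrite mule_ge0.
by rewrite muleC lee_wpmul2r.
Qed.

Lemma mixture_ge (K : R) A : 0 <= K -> (forall j, (K%:E <= component j A)%E) ->
  (K%:E <= mixture A)%E.
Proof.
move=> K0 h; rewrite mixtureE -[leLHS]mule1 -series_halves -nneseriesZl//.
apply: lee_nneseries => [j _ _|j _]; first by rewrite mule_ge0// lee_fin.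
by rewrite muleC lee_wpmul2l.
Qed.

Lemma mixture_ge_component j A : ((2 ^- j.+1)%:E * component j A <= mixture A)%E.
Proof.
rewrite mixtureE; apply: le_trans (nneseries_lim_ge j.+1 _); last first.
  by move=> k _ _; rewrite mule_ge0.
rewrite big_nat_recr//= leeDr//; apply: sume_ge0 => k _.
by rewrite mule_ge0.
Qed.

Lemma mixture_setT : mixture setT = 1%E.
Proof.
have p1 j : component j setT = 1%E.
  rewrite /component cascade_inside// setTI cascade_cell//=; last exact: a0.
  by rewrite expr0 divr1.
by apply/eqP; rewrite eq_le mixture_le ?mixture_ge// => j; rewrite p1.
Qed.

Lemma mixture_dominated : mixture `<< lambda.
Proof.
move=> N N0 A mA AN; apply/eqP; rewrite eq_le measure_ge0 andbT.
apply: mixture_le => // j; rewrite /component cascadeE// big1// => i _.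
rewrite (N0 (A `&` cell (n j) i)) ?mule0//.
  by apply: measurableI => //; exact: measurable_cell.
exact: subset_trans (@subIsetl _ _ _) AN.
Qed.

Lemma msupport_mixture : msupport mixture = `[0, 1]%classic.
Proof.
apply/seteqP; split => x /=; rewrite in_itv /=.
- move=> hx; rewrite !leNgt; apply/andP; split; apply/negP => x01.
    have e0 : 0 < - x by lra.
    have := hx _ e0; rewrite ltNge => /negP; apply; apply: mixture_le => // j.
    rewrite /component cascade_outside// -subset0 => y [/= h /cellP].
    by move: h; rewrite /ball /= ltr_norml expr0 mulr1; lra.
  have e0 : 0 < x - 1 by lra.
  have := hx _ e0; rewrite ltNge => /negP; apply; apply: mixture_le => // j.
  rewrite /component cascade_outside// -subset0 => y [/= h /cellP].
  by move: h; rewrite /ball /= ltr_norml expr0 mulr1; lra.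
- move=> hx e e0.
  have [m /andP[hm _]] := @triadic_scale R (Num.min e 1) (ltac:(
    by rewrite lt_min e0 ltr01 ge_min lexx orbT)).
  have {}hm : 3 ^- m.+1 < e by apply: lt_le_trans hm _; rewrite ge_min lexx.
  have [i hi ix] := cell_near m.+1 hx.
  apply: lt_le_trans (mixture_ge_component 0 _).
  apply: mule_gt0; first by rewrite lte_fin invr_gt0 exprn_gt0.
  apply: lt_le_trans (cascade_ball_ge (ha 0) (a0 (j := 0)) hi ix hm).
  by rewrite lte_fin divr_gt0 ?exprn_gt0// cell_weight_gt0.
Qed.

Lemma mixture_dim_le (alpha : R) : 1 < alpha ->
  exists2 K : R, 0 < K & forall r s x : R, 0 < r -> r < s -> s < 1 -> 0 <= x <= 1 ->
  (mixture (ball x s) <= (K * (s / r) `^ alpha)%:E * mixture (ball x r))%E.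
Proof.
move=> al1; have [C hC] := uniform_descent n al1.
have C0 : 1 <= C by have := hC 0%N 0%N 0%N; rewrite big_ord0 expr0 powR1 !mulr1.
exists (9 * C * 9 `^ alpha).
  by rewrite !mulr_gt0 ?powR_gt0//; lra.
move=> r s x r0 rs s1 hx; apply: mixture_le_scale.
  by rewrite !mulr_ge0 ?powR_ge0//; lra.
move=> j; apply: cascade_dim_bound (ha j) (a0 (j := j)) _ (hC j) _ _ _ _ _ _ _ => //.
lra.
Qed.

(** The leftmost cells have only outer digits, hence weight at most 1. *)
Lemma mixture_ball0_le m : (mixture (ball 0%R (3 ^- m)%R) <= (3 ^- m)%:E)%E.
Proof.
apply: mixture_le => [|j]; first by rewrite invr_ge0 exprn_ge0.
rewrite /component cascade_inside//.
apply: (@le_trans _ _ (component j (cell m 0))).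
  apply: le_measure; rewrite ?inE.
  - by apply: measurableI; [exact: measurable_ball|exact: measurable_cell].
  - exact: measurable_cell.
  - move=> y [yb /cellP]; rewrite expr0 mulr1 => /andP[y0 _]; apply/cellP.
    rewrite mulr_ge0 ?exprn_ge0//=.
    have p : 0 < 3 ^+ m :> R by rewrite exprn_gt0.
    move: yb; rewrite /ball /= sub0r normrN ger0_norm// => yb.
    by rewrite -ltr_pdivlMr// div1r.
rewrite /component cascade_cell ?expn_gt0//; last exact: a0.
rewrite lee_fin ler_pdivrMr ?exprn_gt0// mulVf ?expf_neq0//.
exact: cell_weight_leftmost.
Qed.

(** The ball contains the leftmost third, whose mass is (1 - a) / 3 >= 1 / 6. *)
Lemma mixture_ball0_ge : ((6^-1)%:E <= mixture (ball 0%R (3 / 4)%R))%E.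
Proof.
apply: mixture_ge => [|j]; first by rewrite invr_ge0.
apply: le_trans (cascade_ball_ge (m := 1) (i := 0) (ha j) (a0 (j := j)) _ _ _) => //.
- rewrite lee_fin /= /digit_weight /= expr1 mul1r.
  by have := ha j 0; lra.
- by rewrite mul0r lexx ler0n.
- by rewrite expr1; lra.
Qed.

End Mixture.

(** * The theorem *)

(** The base is the quotient of the radii 3 / 4 and 3^-(m+1). *)
Lemma powR_unbounded (R : realType) (e D : R) : 0 < e ->
  exists m : nat, D < (3 / 4 * 3 ^+ m.+1) `^ e.
Proof.
move=> e0.
have [D0|D0] := leP D 0.
  by exists 0%N; apply: le_lt_trans D0 _; rewrite powR_gt0// mulr_gt0 ?exprn_gt0//; lra.
have [m hm] : exists m : nat, D `^ e^-1 < m%:R.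
  by exists (Num.bound (D `^ e^-1)); exact: archi_boundP (powR_ge0 _ _).
exists m.
have hD : D `^ e^-1 < 3 / 4 * 3 ^+ m.+1.
  apply: lt_le_trans hm _.
  have : m%:R <= 3 ^+ m :> R by rewrite -natrX ler_nat ltnW// ltn_expl.
  have : 0 <= m%:R :> R by [].
  by rewrite exprS; lra.
have -> : D = (D `^ e^-1) `^ e by rewrite -powRrM mulVf ?gt_eqF// powRr1// ltW.
by apply: gt0_ltr_powR; rewrite ?nnegrE ?powR_ge0//; apply: le_trans (ltW hD); exact: powR_ge0.
Qed.

(** Normalization by a total mass equal to 1 changes nothing and yields the
    structure of a probability. *)
Lemma measure_to_probability (R : realType)
    (mu : {measure set (measurableTypeR R) -> \bar R}) :
  mu setT = 1%E ->
  exists P : probability (measurableTypeR R) R, P = mu :> (set _ -> \bar R).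
Proof.
move=> mu1; exists (mnormalize mu (dirac (0 : measurableTypeR R))).
apply/funext => A; rewrite /= /mnormalize mu1.
by rewrite onee_eq0/= invr1 mule1.
Qed.

Theorem theorem4p1 (R : realType) :
  exists mu : probability (measurableTypeR R) R,
    [/\ compact (msupport mu),
        mu `<< (@lebesgue_measure R),
        assouad_dim mu = 1%:E
      & forall p : R, 1 < p -> ~ in_Lp mu p].
Proof.
pose T (j : nat) : R := 2 ^+ (j * j + j + 3).
have T0 j : 0 < T j by rewrite exprn_gt0.
(* Half of the j-th component, of total weight 2^-(j+2) in the mixture, is put
   on a set of Lebesgue measure at most 1 / T j. *)
have [n hn] := choice (fun j => cascade_concentrates (step_size_bounds R j) (T0 j)).
have [P PE] := measure_to_probability (mixture_setT R n).
have suppE : msupport P = `[0, 1]%classic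
  by rewrite -(msupport_mixture _ n) /msupport -PE.
exists P; split.
- by rewrite suppE; exact: segment_compact.
- by have := @mixture_dominated R n; rewrite -PE.
- have Pfin (x r : R) : P (ball x r) \is a fin_num.
    by apply: fin_num_measure; exact: measurable_ball.
  have Ppos (x r : R) : 0 <= x <= 1 -> 0 < r -> 0 < fine (P (ball x r)).
    move=> hx r0; rewrite -lte_fin fineK//.
    have : msupport P x by rewrite suppE /= in_itv.
    exact.
  apply/eqP; rewrite eq_le; apply/andP; split.
    apply/lee_addgt0Pr => e e0; apply: ereal_inf_lbound; exists (1 + e) => //=.
    have [K K0 hK] := @mixture_dim_le R n (1 + e) (ltac:(lra)).
    exists K => // r s x r0 rs s1; rewrite suppE /= in_itv /= => hx.
    rewrite ler_pdivrMr ?Ppos// -lee_fin EFinM !fineK//.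
    by have := hK r s x r0 rs s1 hx; rewrite -PE.
  apply: le_ereal_inf_tmp => _ [alpha /= [C C0 hC] <-].
  rewrite lee_fin leNgt; apply/negP => al1.
  (* Radii 3 / 4 and 3^-(m+1) at the centre 0: the quotient of the masses is
     at least 3^(m+1) / 6 = 2/9 * y, where y is the quotient of the radii, and
     this beats C * y `^ alpha for large m when alpha < 1. *)
  have [m hm] := @powR_unbounded R (1 - alpha) (9 / 2 * C) (ltac:(lra)).
  have z01 : 0 <= (0 : R) <= 1 by rewrite lexx ler01.
  have r0 : 0 < 3 ^- m.+1 :> R by rewrite invr_gt0 exprn_gt0.
  have r1 : 3 ^- m.+1 <= 3^-1 :> R.
    by rewrite lef_pV2 ?posrE ?exprn_gt0// exprS ler_peMr// exprn_ege1// ler1n.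
  have := hC (3 ^- m.+1) (3 / 4) 0 r0 (ltac:(lra)) (ltac:(lra)).
  rewrite suppE /= in_itv /= z01 => /(_ isT).
  rewrite ler_pdivrMr ?Ppos// invrK.
  set y := 3 / 4 * 3 ^+ m.+1 in hm * => hy.
  have big : 6^-1 <= fine (P (ball 0 (3 / 4))).
    rewrite -lee_fin fineK//.
    by have := @mixture_ball0_ge R n; rewrite -PE.
  have small : fine (P (ball 0 (3 ^- m.+1))) <= 3 ^- m.+1.
    rewrite -lee_fin fineK//.
    by have := @mixture_ball0_le R n m.+1; rewrite -PE.
  have y0 : 0 < y by rewrite mulr_gt0 ?exprn_gt0//; lra.
  have := le_trans (le_trans big hy) (ler_wpM2l _ small).
  rewrite mulr_ge0 ?powR_ge0 ?(ltW C0)// => /(_ isT).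
  rewrite ler_pdivlMr ?exprn_gt0// => h.
  have yE : y = y `^ (1 - alpha) * y `^ alpha.
    by rewrite -powRD ?subrK ?powRr1 ?(ltW y0)// ?(gt_eqF y0) ?implybT.
  have q0 : 0 < y `^ alpha by rewrite powR_gt0.
  have : 9 / 2 * C * y `^ alpha < y by rewrite {2}yE ltr_pM2r.
  by rewrite {2}/y; lra.
- apply: concentrated_not_in_Lp => j.
  exists (heavy_cells (truncated (step_size R j) (n j)) (n j) (T j)); split.
  + exact: measurable_heavy_cells.
  + apply: lebesgue_heavy_cells => //; apply: admissible_truncated.
    by have := step_size_bounds R j; lra.
  + have := mixture_ge_component n j (heavy_cells (truncated (step_size R j) (n j)) (n j) (T j)).
    rewrite -PE; apply: le_trans.
    apply: le_trans (lee_wpmul2l _ (hn j)); last by rewrite lee_fin invr_ge0 exprn_ge0.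
    by rewrite -EFinM lee_fin addn2 exprS invfM mulrC.
Qed.
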